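(* For each $N\in\{1,\dots,10\}$ let $F_N(c)$ and $R_N(c)$ be the response force and the resistance of the $N$-th arrangement of four current-conducting elastoplastic springs with elastic limits $c=(c_1,c_2,c_3,c_4)$, $c_i\ge 0$, as listed in the context, and consider the optimization problem $$F_N(c)\ge 0.75,\qquad 0.2\,F_N(c)+0.1\,R_N(c)\ge 0.5,\qquad C(c)=c_1+c_2+c_3+c_4\to\min .$$ Let $c_{2*}$ be the solution of $$0.2\cdot 0.75+0.1\left(\frac{1}{0.75}+\frac{1}{0.75-\frac{c_{2*}}{2}}\right)=0.5 ,$$ so that $c_{2*}\approx 0.577$. Then: (i) for $N=9$, the minimum is attained at $c_*=(0.75,\;c_{2*},\;c_{2*},\;0.75-c_{2*})\approx(0.75,\,0.577,\,0.577,\,0.173)$, and the minimal cost is $C_{\min}=C(c_* )=2\cdot 0.75+c_{2*}\approx 2.077$; (ii) for every $N\in\{1,2,3,4,5,6,7,8,10\}$, every $c$ satisfying the constraints of the $N$-th problem has cost $C(c)>C_{\min}$.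
   Context: Four springs with elastic limits $c_1,\dots,c_4\ge 0$ are arranged between two end nodes. Spring $i$ has electrical resistance $R_i=1/c_i$. The resistance $R$ of the arrangement follows the usual series/parallel rules. The response force $F$ is the maximal stress of the arrangement: for a series connection it is the minimum of the response forces of the components, for a parallel connection it is their sum. A series connection containing a component with zero elastic limit is assigned conductance $0$ (i.e. $1/(1/a+1/b)$ is read as $0$ if $a=0$ or $b=0$, and similarly for three terms). The condition $F\ge 0.75$ ensures that $R$ is finite. The ten arrangements have: 1. $F_1=\min(c_1,\,c_2+c_3,\,c_4)$, $R_1(c)=\frac1{c_1}+\frac1{c_2+c_3}+\frac1{c_4}$. 2. $F_2=\min(c_1,c_2,c_3,c_4)$, $R_2(c)=\frac1{c_1}+\frac1{c_2}+\frac1{c_3}+\frac1{c_4}$. 3. $F_3=\min(c_1,c_2)+\min(c_3,c_4)$, $R_3(c)=\left(\frac{1}{\frac1{c_1}+\frac1{c_2}}+\frac{1}{\frac1{c_3}+\frac1{c_4}}\right)^{-1}$. 4. $F_4=\min(c_1,c_2,c_3)+c_4$, $R_4(c)=\left(\frac{1}{\frac1{c_1}+\frac1{c_2}+\frac1{c_3}}+c_4\right)^{-1}$. 5. $F_5=\min(c_1,c_2)+c_3+c_4$, $R_5(c)=\left(\frac{1}{\frac1{c_1}+\frac1{c_2}}+c_3+c_4\right)^{-1}$. 6. $F_6=\min(c_1,\,c_2+c_3+c_4)$, $R_6(c)=\frac1{c_1}+\frac1{c_2+c_3+c_4}$. 7. $F_7=\min(c_1+c_3,\,c_2+c_4)$,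 $R_7(c)=\frac1{c_1+c_3}+\frac1{c_2+c_4}$. 8. $F_8=c_1+c_2+c_3+c_4$, $R_8(c)=\frac1{c_1+c_2+c_3+c_4}$. 9. $F_9=\min\bigl(c_1,\,c_4+\min(c_2,c_3)\bigr)$, $R_9(c)=\frac1{c_1}+\left(c_4+\frac{1}{\frac1{c_2}+\frac1{c_3}}\right)^{-1}$. 10. $F_{10}=c_4+\min(c_1,\,c_2+c_3)$, $R_{10}(c)=\left(c_4+\frac{1}{\frac1{c_1}+\frac1{c_2+c_3}}\right)^{-1}$. Here $R_N(c)$ with argument $c$ denotes the total resistance of arrangement $N$ (not the resistance of a single spring). The numerical values are rounded to three decimals. *)

(* Defs.v *)
From Stdlib Require Import Reals.
Open Scope R_scope.

Definition limits : Type := (R * R * R * R)%type.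

Definition nonneg (c : limits) : Prop :=
  let '(c1, c2, c3, c4) := c in 0 <= c1 /\ 0 <= c2 /\ 0 <= c3 /\ 0 <= c4.

Definition cost (c : limits) : R :=
  let '(c1, c2, c3, c4) := c in c1 + c2 + c3 + c4.

(* Conductance of a series connection of components with conductances a, b
   (resp. a, b, d). The zero tests are needed because 1 / 0 = 0 in R: without
   them a zero component would be dropped rather than break the circuit. *)
Definition series2 (a b : R) : R :=
  if Req_dec_T a 0 then 0
  else if Req_dec_T b 0 then 0
  else 1 / (1 / a + 1 / b).

Definition series3 (a b d : R) : R :=
  if Req_dec_T a 0 then 0
  else if Req_dec_T b 0 then 0
  else if Req_dec_T d 0 then 0
  else 1 / (1 / a + 1 / b + 1 / d).

(* Arrangements are numbered from 1 to 10; other indices get a dummy value. *)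
Definition force (N : nat) (c : limits) : R :=
  let '(c1, c2, c3, c4) := c in
  match N with
  | 1 => Rmin c1 (Rmin (c2 + c3) c4)
  | 2 => Rmin c1 (Rmin c2 (Rmin c3 c4))
  | 3 => Rmin c1 c2 + Rmin c3 c4
  | 4 => Rmin c1 (Rmin c2 c3) + c4
  | 5 => Rmin c1 c2 + c3 + c4
  | 6 => Rmin c1 (c2 + c3 + c4)
  | 7 => Rmin (c1 + c3) (c2 + c4)
  | 8 => c1 + c2 + c3 + c4
  | 9 => Rmin c1 (c4 + Rmin c2 c3)
  | 10 => c4 + Rmin c1 (c2 + c3)
  | _ => 0
  end.

(* The total resistance is infinite when the total conductance is 0; the real
   value given here is then meaningless, but this never happens for a
   nonnegative c with [force N c > 0], in particular on the feasible set. *)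
Definition resistance (N : nat) (c : limits) : R :=
  let '(c1, c2, c3, c4) := c in
  match N with
  | 1 => 1 / c1 + 1 / (c2 + c3) + 1 / c4
  | 2 => 1 / c1 + 1 / c2 + 1 / c3 + 1 / c4
  | 3 => / (series2 c1 c2 + series2 c3 c4)
  | 4 => / (series3 c1 c2 c3 + c4)
  | 5 => / (series2 c1 c2 + c3 + c4)
  | 6 => 1 / c1 + 1 / (c2 + c3 + c4)
  | 7 => 1 / (c1 + c3) + 1 / (c2 + c4)
  | 8 => 1 / (c1 + c2 + c3 + c4)
  | 9 => 1 / c1 + / (c4 + series2 c2 c3)
  | 10 => / (c4 + series2 c1 (c2 + c3))
  | _ => 0
  end.

Definition feasible (N : nat) (c : limits) : Prop :=
  nonneg c /\
  force N c >= 0.75 /\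
  0.2 * force N c + 0.1 * resistance N c >= 0.5.

Definition attains_minimum (N : nat) (c : limits) : Prop :=
  feasible N c /\ forall c', feasible N c' -> cost c <= cost c'.

Definition solves_c2_equation (x : R) : Prop :=
  0.75 - x / 2 <> 0 /\
  0.2 * 0.75 + 0.1 * (1 / 0.75 + 1 / (0.75 - x / 2)) = 0.5.

Definition optimal_limits (x : R) : limits := (0.75, x, x, 0.75 - x).

(* x rounds to y, where y is given with three decimals. *)
Definition approx3 (x y : R) : Prop := Rabs (x - y) < 0.0005.

(* Main.v *)
Require Import Defs.
From Stdlib Require Import Reals.
From Stdlib Require Import Lra Lia.
Open Scope R_scope.

(** The equation for [c2s] is linear in [1 / (0.75 - x / 2)]; its root is
    [15/26], so the claimed minimal cost is [27/13].  In units of [0.1] the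
    second constraint reads [2 * F + R >= 5].

    A small force and a large resistance compete with a small cost.  A series
    connection of [k] components has conductance at least [1/k] of its force
    (lemmas [series2_lower], [series3_lower]), and it costs at least [k] times
    its force.  Write [F] for the force and [C] for the cost.
    - Three or four stages in series cost at least [3 * F], hence at least
      [9/4], which exceeds [27/13].
    - Two blocks in series, each without a chain inside, and parallel
      connections of single springs and chains of two stages have total
      conductance at least both [F / 2] and [(3 * F - C) / 2]; then
      [2 * F + R < 5] whenever [3/4 <= F <= C <= 27/13]
      ([two_stage_resistance_small]).
    - A chain of three in parallel with one spring has conductance at least
      [(4 * F - C) / 3], with the same outcome
      ([three_stage_resistance_small]).
    - In arrangement 9 one spring is in series with a block containing a chain
      of two.  The block has conductance at least [2 * F - C / 2], so that
      [2 * F + R] is at most [2 * F + 1 / F + 1 / (2 * F - C / 2)].  This bound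
      grows with [C].  For [C = 27/13] and [3/4 <= F <= C / 2] it is at most
      [5], with equality at [F = 3/4], which is the optimum
      ([arrangement9_cost]). *)

(** * Conductance of a chain against its weakest component *)

Lemma series2_lower (a b m : R) :
  0 <= a -> 0 <= b -> m <= a -> m <= b -> m / 2 <= series2 a b.
Proof.
  intros Ha Hb Hma Hmb. unfold series2.
  destruct (Req_dec_T a 0); [lra|]. destruct (Req_dec_T b 0); [lra|].
  replace (1 / (1 / a + 1 / b)) with (a * b / (a + b)) by (field; lra).
  apply Rmult_le_reg_r with (a + b); [lra|].
  unfold Rdiv at 2. rewrite Rmult_assoc, Rinv_l by lra. nra.
Qed.

Lemma series3_lower (a b d m : R) :
  0 <= a -> 0 <= b -> 0 <= d -> m <= a -> m <= b -> m <= d ->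
  m / 3 <= series3 a b d.
Proof.
  intros Ha Hb Hd Hma Hmb Hmd. unfold series3.
  destruct (Req_dec_T a 0); [lra|]. destruct (Req_dec_T b 0); [lra|].
  destruct (Req_dec_T d 0); [lra|].
  assert (Ia : 0 < / a) by (apply Rinv_0_lt_compat; lra).
  assert (Ib : 0 < / b) by (apply Rinv_0_lt_compat; lra).
  assert (Id : 0 < / d) by (apply Rinv_0_lt_compat; lra).
  assert (Ea : a * / a = 1) by (apply Rinv_r; lra).
  assert (Eb : b * / b = 1) by (apply Rinv_r; lra).
  assert (Ed : d * / d = 1) by (apply Rinv_r; lra).
  apply Rmult_le_reg_r with (1 / a + 1 / b + 1 / d); [lra|].
  replace (1 / (1 / a + 1 / b + 1 / d) * (1 / a + 1 / b + 1 / d)) with 1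
    by (field; nra).
  assert (m * / a <= 1) by (rewrite <- Ea; apply Rmult_le_compat_r; lra).
  assert (m * / b <= 1) by (rewrite <- Eb; apply Rmult_le_compat_r; lra).
  assert (m * / d <= 1) by (rewrite <- Ed; apply Rmult_le_compat_r; lra).
  lra.
Qed.

(** * Force and resistance within the cost bound *)

Lemma resistance_lt (g r : R) : 0 < g -> 1 < r * g -> / g < r.
Proof.
  intros Hg H. apply Rmult_lt_reg_r with g; [lra|].
  rewrite Rinv_l by lra. lra.
Qed.

(** The first bound on the conductance is enough for [F < 2], because
    [2 * F + 2 / F < 5] on [(1/2, 2)].  For [F] close to [C] nearly all of the
    cost goes into springs outside the chains, and the second bound shows that
    the conductance is then nearly [F]. *)
Lemma two_stage_resistance_small (F g C : R) :
  3 / 4 <= F -> F <= C -> C <= 27 / 13 ->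
  F / 2 <= g -> (3 * F - C) / 2 <= g -> 2 * F + / g < 5.
Proof.
  intros HF HFC HC Hg1 Hg2.
  enough (/ g < 5 - 2 * F) by lra.
  apply resistance_lt; [lra|].
  destruct (Rle_lt_dec F (19 / 10)); nra.
Qed.

Lemma three_stage_resistance_small (F g C : R) :
  3 / 4 <= F -> F <= C -> C <= 27 / 13 ->
  (4 * F - C) / 3 <= g -> 2 * F + / g < 5.
Proof.
  intros HF HFC HC Hg.
  enough (/ g < 5 - 2 * F) by lra.
  apply resistance_lt; nra.
Qed.

(** Each block has conductance at least [F], so the total resistance is at most
    that of a conductance [F / 2]. *)
Lemma two_series_blocks_cost (F a b C : R) :
  3 / 4 <= F -> F <= a -> F <= b -> a + b <= C ->
  2 * F + (1 / a + 1 / b) >= 5 -> 27 / 13 < C.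
Proof.
  intros HF Ha Hb HC HR.
  apply Rnot_le_lt; intro HK.
  assert (Ia : / a <= / F) by (apply Rinv_le_contravar; lra).
  assert (Ib : / b <= / F) by (apply Rinv_le_contravar; lra).
  assert (H : / (F / 2) = 2 * / F) by (field; lra).
  pose proof (two_stage_resistance_small F (F / 2) C).
  lra.
Qed.

(** * Arrangement 9 *)

(** The parameters are the first spring [a], the spring [d] parallel to the
    chain, and the force [m] and conductance [s] of the chain, whose two
    springs cost at least [2 * m]. *)
Lemma arrangement9_cost (F a d m s C : R) :
  3 / 4 <= F -> F <= a -> F <= d + m -> 0 <= d -> 0 <= m -> m / 2 <= s ->
  a + 2 * m + d <= C ->
  2 * F + (1 / a + / (d + s)) >= 5 -> 27 / 13 <= C.
Proof.
  intros HF Ha Hu Hd Hm Hs HC HR.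
  apply Rnot_lt_le; intro HK.
  assert (Ia : / a <= / F) by (apply Rinv_le_contravar; lra).
  set (h := 2 * F - C / 2).
  assert (Ig : / (d + s) <= / h)
    by (apply Rinv_le_contravar; unfold h; lra).
  assert (Hh : 6 / 13 < h) by (unfold h; lra).
  assert (HF2 : F <= C / 2) by lra.
  (* This is 2 F + 1 / F + 1 / h < 5, multiplied by F h. *)
  assert (HX : F + h < (5 - 2 * F) * (F * h)).
  { (* The difference of the two sides increases with h, so h may be replaced
       by its value 2 F - 27/26 at the critical cost. *)
    assert (Hh2 : 2 * F - 27 / 26 < h) by (unfold h; lra).
    assert (F <= 27 / 26) by lra.
    assert (0 < (5 - 2 * F) * F - 1) by nra.
    assert (F <= ((5 - 2 * F) * F - 1) * (2 * F - 27 / 26)).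
    { (* Equality holds at F = 3/4, so F - 3/4 divides the difference, a cubic
         in F; the other factor is positive on [3/4, 27/26]. *)
      assert (0 <= (F - 3 / 4) * (- 4 * F * F + 118 / 13 * F - 18 / 13)).
      { apply Rmult_le_pos; nra. }
      nra. }
    nra. }
  assert (HI : / F + / h < 5 - 2 * F).
  { replace (/ F + / h) with ((F + h) * / (F * h)) by (field; lra).
    assert (0 < F * h) by nra.
    apply Rmult_lt_reg_r with (F * h); [lra|].
    rewrite Rmult_assoc, Rinv_l by lra. lra. }
  lra.
Qed.

Lemma c2_equation_root (x : R) : solves_c2_equation x <-> x = 15 / 26.
Proof.
  unfold solves_c2_equation. split.
  - intros [Hx E].
    assert (EI : / (0.75 - x / 2) = 13 / 6) by lra.
    apply (f_equal Rinv) in EI. rewrite Rinv_inv in EI. lra.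
  - intros ->. split; [lra|].
    replace (0.75 - 15 / 26 / 2) with (6 / 13) by lra. lra.
Qed.

Lemma optimal_limits_feasible : feasible 9 (optimal_limits (15 / 26)).
Proof.
  unfold feasible, nonneg, optimal_limits, force, resistance, series2.
  destruct (Req_dec_T (15 / 26) 0); [lra|].
  rewrite (Rmin_left (15 / 26) (15 / 26)) by lra.
  rewrite Rmin_left by lra.
  replace 0.75 with (3 / 4) by lra.
  replace (1 / (3 / 4) + / (3 / 4 - 15 / 26 + 1 / (1 / (15 / 26) + 1 / (15 / 26))))
    with (7 / 2) by field.
  repeat split; lra.
Qed.

(** * The remaining arrangements *)

(** In arrangements 1 and 2 the force constraint alone excludes the cost
    [27/13]; in the others the force is bounded below by the first constraint
    and the resistance turns out too small for the second. *)
Lemma other_arrangements_cost (N : nat) (c : limits) :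
  (1 <= N <= 10)%nat -> N <> 9%nat -> feasible N c -> 27 / 13 < cost c.
Proof.
  intros HN HN9. destruct c as [[[c1 c2] c3] c4].
  unfold feasible, nonneg, cost. intros [(H1 & H2 & H3 & H4) [HF HR]].
  assert (HF' : 3 / 4 <= force N (c1, c2, c3, c4)) by lra.
  assert (HR' : 2 * force N (c1, c2, c3, c4)
                + resistance N (c1, c2, c3, c4) >= 5) by lra.
  clear HF HR.
  assert (cases : (N = 1 \/ N = 2 \/ N = 3 \/ N = 4 \/ N = 5 \/
                   N = 6 \/ N = 7 \/ N = 8 \/ N = 10)%nat) by lia.
  destruct cases as [->|[->|[->|[->|[->|[->|[->|[->| ->]]]]]]]];
    cbn [force resistance] in HF', HR'; clear HN HN9.
  - pose proof (Rmin_l c1 (Rmin (c2 + c3) c4)).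
    pose proof (Rmin_r c1 (Rmin (c2 + c3) c4)).
    pose proof (Rmin_l (c2 + c3) c4). pose proof (Rmin_r (c2 + c3) c4).
    lra.
  - pose proof (Rmin_l c1 (Rmin c2 (Rmin c3 c4))).
    pose proof (Rmin_r c1 (Rmin c2 (Rmin c3 c4))).
    pose proof (Rmin_l c2 (Rmin c3 c4)). pose proof (Rmin_r c2 (Rmin c3 c4)).
    pose proof (Rmin_l c3 c4). pose proof (Rmin_r c3 c4).
    lra.
  - pose proof (Rmin_l c1 c2). pose proof (Rmin_r c1 c2).
    pose proof (Rmin_l c3 c4). pose proof (Rmin_r c3 c4).
    pose proof (series2_lower c1 c2 (Rmin c1 c2)).
    pose proof (series2_lower c3 c4 (Rmin c3 c4)).
    apply Rnot_le_lt; intro HK.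
    pose proof (two_stage_resistance_small (Rmin c1 c2 + Rmin c3 c4)
      (series2 c1 c2 + series2 c3 c4) (c1 + c2 + c3 + c4)).
    lra.
  - pose proof (Rmin_l c1 (Rmin c2 c3)). pose proof (Rmin_r c1 (Rmin c2 c3)).
    pose proof (Rmin_l c2 c3). pose proof (Rmin_r c2 c3).
    pose proof (series3_lower c1 c2 c3 (Rmin c1 (Rmin c2 c3))).
    apply Rnot_le_lt; intro HK.
    pose proof (three_stage_resistance_small (Rmin c1 (Rmin c2 c3) + c4)
      (series3 c1 c2 c3 + c4) (c1 + c2 + c3 + c4)).
    lra.
  - pose proof (Rmin_l c1 c2). pose proof (Rmin_r c1 c2).
    pose proof (Rmin_glb c1 c2 0 H1 H2).
    pose proof (series2_lower c1 c2 (Rmin c1 c2)).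
    apply Rnot_le_lt; intro HK.
    pose proof (two_stage_resistance_small (Rmin c1 c2 + c3 + c4)
      (series2 c1 c2 + c3 + c4) (c1 + c2 + c3 + c4)).
    lra.
  - apply (two_series_blocks_cost _ c1 (c2 + c3 + c4) _ HF'
      (Rmin_l _ _) (Rmin_r _ _)); lra.
  - apply (two_series_blocks_cost _ (c1 + c3) (c2 + c4) _ HF'
      (Rmin_l _ _) (Rmin_r _ _)); lra.
  - apply Rnot_le_lt; intro HK.
    pose proof (two_stage_resistance_small (c1 + c2 + c3 + c4)
      (c1 + c2 + c3 + c4) (c1 + c2 + c3 + c4)).
    lra.
  - pose proof (Rmin_l c1 (c2 + c3)). pose proof (Rmin_r c1 (c2 + c3)).
    assert (0 <= Rmin c1 (c2 + c3)) by (apply Rmin_glb; lra).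
    pose proof (series2_lower c1 (c2 + c3) (Rmin c1 (c2 + c3))).
    apply Rnot_le_lt; intro HK.
    pose proof (two_stage_resistance_small (c4 + Rmin c1 (c2 + c3))
      (c4 + series2 c1 (c2 + c3)) (c1 + c2 + c3 + c4)).
    lra.
Qed.

Theorem mainTheorem1 :
  exists c2s : R,
    unique solves_c2_equation c2s /\
    approx3 c2s 0.577 /\
    (attains_minimum 9 (optimal_limits c2s) /\
     approx3 (0.75 - c2s) 0.173 /\
     cost (optimal_limits c2s) = 2 * 0.75 + c2s /\
     approx3 (cost (optimal_limits c2s)) 2.077) /\
    (forall N : nat, (1 <= N <= 10)%nat -> N <> 9%nat ->
       forall c : limits, feasible N c -> cost c > cost (optimal_limits c2s)).
Proof.
  exists (15 / 26).
  assert (Hcost : cost (optimal_limits (15 / 26)) = 27 / 13)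
    by (unfold cost, optimal_limits; lra).
  rewrite Hcost.
  split; [|split; [|split; [split; [|split; [|split]]|]]].
  - split.
    + now apply c2_equation_root.
    + intros x Hx. symmetry. now apply c2_equation_root.
  - apply Rabs_def1; lra.
  - split; [exact optimal_limits_feasible|].
    intros [[[c1 c2] c3] c4] [(H1 & H2 & H3 & H4) [HF HR]].
    rewrite Hcost. cbn [force resistance cost] in *.
    pose proof (Rmin_l c2 c3). pose proof (Rmin_r c2 c3).
    pose proof (Rmin_glb c2 c3 0 H2 H3).
    pose proof (series2_lower c2 c3 (Rmin c2 c3)).
    apply (arrangement9_cost (Rmin c1 (c4 + Rmin c2 c3)) c1 c4 (Rmin c2 c3)
      (series2 c2 c3)); try apply Rmin_l; try apply Rmin_r; lra.
  - apply Rabs_def1; lra.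
  - lra.
  - apply Rabs_def1; lra.
  - intros N HN HN9 c Hc.
    now apply Rlt_gt, (other_arrangements_cost N).
Qed.
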